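(* Let $\{D_n\}_{n\in\mathbb{N}}$ be a system of Dedekind domains and $D=\bigcup_{n\in\mathbb{N}}D_n$. Then the following statements are equivalent. (1) $D$ is a Dedekind domain. (2) For each $n\in\mathbb{N}$ and a prime ideal $P$ of $D_n$, there exists $l\ge n$ so that for each $m\ge l$, a prime ideal of $D_m$ that contains $P$ is inert in $D_{m+1}$.
   Context: A system of Dedekind domains is a strictly increasing chain $D_1\subsetneq D_2\subsetneq D_3\subsetneq\cdots$ of Dedekind domains (each a subring of the next) such that: (i) each $D_j$ is not a field; (ii) for all $i<j$, each maximal ideal $P$ of $D_i$ survives in $D_j$, i.e. $PD_j\neq D_j$; (iii) for each $j\in\mathbb{N}$, each maximal ideal of $D_j$ contracts to a maximal ideal of $D_1$. Here $\mathbb{N}$ is the set of positive integers. If $T_1\subseteq T_2$ is an extension of Dedekind domains and $Q$ is a prime ideal of $T_1$, then $Q$ is inert in $T_2$ if $QT_2$ is a prime ideal of $T_2$.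
   Formalization: In (2) the prime ideal P of D_n is taken to be nonzero; with P = 0 allowed, (2) would require all primes of D_m to be inert for every large m, and (1) would not imply it. *)

(* Defs.v *)
From mathcomp Require Import all_boot all_algebra.
From mathcomp Require Import boolp classical_sets.

Set Implicit Arguments.
Unset Strict Implicit.
Unset Printing Implicit Defensive.

Import GRing.Theory.
Local Open Scope classical_set_scope.
Local Open Scope ring_scope.

(* Integral domains are represented as subrings A : set K of an ambient field
   K. A chain of integral domains always lives in such a field, namely the
   fraction field of its union. *)
Section Domains.
Variable K : fieldType.
Implicit Types (A B I J P : set K).

Definition is_subring A : Prop := subring_closed (mem A).

Definition is_ideal A I : Prop :=
  [/\ I `<=` A,
      I 0,
      forall x y, I x -> I y -> I (x + y)
    & forall a x, A a -> I x -> I (a * x)].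

Definition gen_ideal A (S : set K) : set K := smallest (is_ideal A) S.

Definition prime_ideal A P : Prop :=
  [/\ is_ideal A P,
      P <> A
    & forall x y, A x -> A y -> P (x * y) -> P x \/ P y].

Definition maximal_ideal A P : Prop :=
  [/\ is_ideal A P,
      P <> A
    & forall J, is_ideal A J -> P `<=` J -> J = P \/ J = A].

Definition noetherian A : Prop :=
  forall I, is_ideal A I -> exists s : seq K, I = gen_ideal A [set` s].

(* The fraction field of A, inside K. *)
Definition frac_field A : set K :=
  [set x | exists a b, [/\ A a, A b, b != 0 & x = a / b]].

Definition integral_over A (x : K) : Prop :=
  exists p : {poly K}, [/\ p \is monic, forall i, A p`_i & root p x].

Definition integrally_closed A : Prop :=
  forall x, frac_field A x -> integral_over A x -> A x.

Definition is_field A : Prop := forall x, A x -> x != 0 -> A x^-1.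

(* Fields are allowed, as usual; systems exclude them explicitly. *)
Definition dedekind A : Prop :=
  [/\ is_subring A,
      noetherian A,
      integrally_closed A
    & forall P, prime_ideal A P -> P <> [set 0] -> maximal_ideal A P].

(* The chain is indexed from 0, so that D 0 is the first ring D_1. *)
Definition dedekind_system (D : nat -> set K) : Prop :=
  [/\ forall n, dedekind (D n) /\ D n `<` D n.+1,
      forall j, ~ is_field (D j),
      forall i j, (i < j)%N -> forall P, maximal_ideal (D i) P ->
        gen_ideal (D j) P <> D j
    & forall j M, maximal_ideal (D j) M -> maximal_ideal (D 0) (M `&` D 0)].

Definition inert B P : Prop := prime_ideal B (gen_ideal B P).

End Domains.

(* Main.v *)
Require Import Defs.
From mathcomp Require Import all_boot all_algebra.
From mathcomp Require Import boolp classical_sets.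

(** The union U of the chain is integrally closed of dimension at most one in
    any case, so only noetherianity is at stake.  If the primes become inert,
    then every nonzero prime N of U is generated by its contraction to some
    D_l, and Cohen's theorem applies.  Conversely, if U is noetherian, then for
    a nonzero prime P of D_n there is one l such that each prime N of U over P
    is generated by its contraction to D_l (noetherian induction on ideals of
    U).  A prime Q of D_m containing P, with m >= l, survives in U, hence lies
    below such an N, and N = Q U.  It remains to descend the equality
    (N ∩ D_{m+1}) U = Q U to D_{m+1}: this is faithful flatness, proved here
    from the invertibility of N ∩ D_{m+1} and the survival of maximal ideals. *)

Set Implicit Arguments.
Unset Strict Implicit.
Unset Printing Implicit Defensive.

Import GRing.Theory.
Local Open Scope classical_set_scope.
Local Open Scope ring_scope.

(** * Finite generation, sums with a principal ideal, colon ideals *)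

Definition fin_gen (K : fieldType) (A I : set K) : Prop :=
  exists s : seq K, I = gen_ideal A [set` s].

(** The ideal [I + x A], given by explicit elements: [gen_ideal] is an intersection and yields no
    linear combinations. *)
Definition add_principal (K : fieldType) (A I : set K) (x : K) : set K :=
  [set y | exists i a, [/\ I i, A a & y = i + a * x]].

Definition colon (K : fieldType) (A I J : set K) : set K :=
  [set c | A c /\ forall x, J x -> I (c * x)].

(** * Chains of sets *)

Section Chains.
Variables (T : eqType) (C : set (set T)).
Hypotheses (C_chain : total_on C subset) (C_neq0 : exists X, C X).

Lemma chain_bigcup_seq (s : seq T) :
  [set` s] `<=` \bigcup_(X in C) X -> exists2 X, C X & [set` s] `<=` X.
Proof.
elim: s => [|x s IH] sC; first by case: C_neq0 => X CX; exists X.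
have [|X CX sX] := IH.
  by move=> y ys; apply: sC; rewrite /= inE ys orbT.
have [|Y CY Yx] := sC x; first by rewrite /= inE eqxx.
have [XY|YX] := C_chain CX CY.
- exists Y => // y; rewrite /= inE => /orP[/eqP->//|ys].
  by apply: XY; apply: sX.
- exists X => // y; rewrite /= inE => /orP[/eqP->|ys]; first exact: YX.
  exact: sX.
Qed.

End Chains.

Lemma nondecreasing_total (T : Type) (F : nat -> set T) :
  (forall m n, (m <= n)%N -> F m `<=` F n) -> total_on (range F) subset.
Proof.
move=> F_mono _ _ [m _ <-] [n _ <-].
by have [mn|/ltnW nm] := leqP m n; [left|right]; apply: F_mono.
Qed.

(** * Ideals of a subring of a field *)

Section Subring.
Variables (K : fieldType) (A : set K).
Hypothesis A_subring : is_subring A.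
Implicit Types (I J P M N S : set K) (x y : K).

Lemma subring1 : A 1.
Proof. by case: A_subring => /set_mem. Qed.

Lemma subringB x y : A x -> A y -> A (x - y).
Proof. by case: A_subring => _ + _ => h /mem_set Ax /mem_set Ay; apply/set_mem/h. Qed.

Lemma subringM x y : A x -> A y -> A (x * y).
Proof. by case: A_subring => _ _ + /mem_set Ax /mem_set Ay => h; apply/set_mem/h. Qed.

Lemma subring0 : A 0.
Proof. by rewrite -(subrr 1); apply: subringB; apply: subring1. Qed.

Lemma subringN x : A x -> A (- x).
Proof. by rewrite -sub0r; apply/subringB/subring0. Qed.

Lemma subringD x y : A x -> A y -> A (x + y).
Proof. by move=> Ax Ay; rewrite -[y]opprK; apply: subringB => //; apply: subringN. Qed.

Lemma is_ideal_self : is_ideal A A.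
Proof. by split=> //; [exact: subring0 | exact: subringD | exact: subringM]. Qed.

Lemma idealB I x y : is_ideal A I -> I x -> I y -> I (x - y).
Proof.
move=> [_ _ ID IM] Ix Iy; apply: ID => //; rewrite -mulN1r; apply: IM => //.
exact/subringN/subring1.
Qed.

Lemma ideal_full I : is_ideal A I -> I 1 -> I = A.
Proof.
move=> [IA _ _ IM] I1; apply/seteqP; split=> // x Ax.
by rewrite -[x]mulr1; apply: IM.
Qed.

Lemma ideal_proper I : is_ideal A I -> I <> A -> ~ I 1.
Proof. by move=> hI IA I1; apply/IA/ideal_full. Qed.

Lemma is_ideal_gen S : S `<=` A -> is_ideal A (gen_ideal A S).
Proof.
move=> SA; split.
- exact: smallest_sub is_ideal_self SA.
- by move=> I [[]].
- by move=> x y gx gy I [hI SI]; case: (hI) => _ _ + _; apply; [apply: gx|apply: gy].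
- by move=> a x Aa gx I [hI SI]; case: (hI) => _ _ _; apply=> //; apply: gx.
Qed.

Lemma gen_ideal_min S I : is_ideal A I -> S `<=` I -> gen_ideal A S `<=` I.
Proof. exact: smallest_sub. Qed.

Lemma sub_gen_ideal S : S `<=` gen_ideal A S.
Proof. exact: sub_gen_smallest. Qed.

Lemma is_ideal_add_principal I x :
  is_ideal A I -> A x -> is_ideal A (add_principal A I x).
Proof.
move=> [IA I0 ID IM] Ax; split.
- by move=> _ [i [a [Ii Aa ->]]]; apply/subringD/subringM => //; apply: IA.
- by exists 0, 0; split; rewrite ?mul0r ?addr0 //; apply: subring0.
- move=> _ _ [i [a [Ii Aa ->]]] [j [b [Ij Ab ->]]].
  exists (i + j), (a + b); split; [exact: ID|exact: subringD|].
  by rewrite mulrDl addrACA.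
- move=> c _ Ac [i [a [Ii Aa ->]]]; exists (c * i), (c * a).
  by split; [exact: IM|exact: subringM|rewrite mulrDr mulrA].
Qed.

Lemma sub_add_principal I x : I `<=` add_principal A I x.
Proof. by move=> i Ii; exists i, 0; split; rewrite ?mul0r ?addr0 //; apply: subring0. Qed.

Lemma mem_add_principal I x : is_ideal A I -> add_principal A I x x.
Proof. by case=> _ I0 _ _; exists 0, 1; split; rewrite ?mul1r ?add0r //; apply: subring1. Qed.

Lemma proper_add_principal I x :
  is_ideal A I -> ~ I x -> I `<` add_principal A I x.
Proof.
move=> hI nIx; split; first exact: sub_add_principal.
by move/(_ x (mem_add_principal x hI)).
Qed.

Lemma is_ideal_colon I J :
  is_ideal A I -> is_ideal A (colon A I J).
Proof.
move=> [IA I0 ID IM]; split.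
- by move=> c [].
- by split; [exact: subring0|move=> x _; rewrite mul0r].
- move=> c d [Ac hc] [Ad hd]; split; first exact: subringD.
  by move=> x Jx; rewrite mulrDl; apply: ID; [apply: hc|apply: hd].
- move=> a c Aa [Ac hc]; split; first exact: subringM.
  by move=> x Jx; rewrite -mulrA; apply: IM => //; apply: hc.
Qed.

Lemma sub_colon I J : is_ideal A I -> J `<=` A -> I `<=` colon A I J.
Proof.
move=> [IA _ _ IM] JA i Ii; split; first exact: IA.
by move=> x Jx; rewrite mulrC; apply: IM => //; apply: JA.
Qed.

Lemma maximal_prime M : maximal_ideal A M -> prime_ideal A M.
Proof.
move=> [hM MA Mmax]; split=> // x y Ax Ay Mxy.
have [Mx|nMx] := pselect (M x); [by left|right].
have [E|E] := Mmax _ (is_ideal_add_principal hM Ax) (@sub_add_principal M x).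
  by case: nMx; rewrite -E; apply: mem_add_principal.
have [m [a [Mm Aa e]]] : add_principal A M x 1 by rewrite E; apply: subring1.
case: (hM) => _ _ MD MM; rewrite -[y]mul1r e mulrDl.
by apply: MD; [rewrite mulrC; apply: MM|rewrite -mulrA; apply: MM].
Qed.

Lemma prime_proper1 P : prime_ideal A P -> ~ P 1.
Proof. by case=> hP PA _; apply: ideal_proper. Qed.

Lemma maximal_eq M I :
  maximal_ideal A M -> is_ideal A I -> ~ I 1 -> M `<=` I -> I = M.
Proof.
move=> [_ _ Mmax] hI nI1 MI; case: (Mmax _ hI MI) => // IA.
by case: nI1; rewrite IA; apply: subring1.
Qed.

Lemma is_ideal_bigcup (C : set (set K)) :
  total_on C subset -> (exists X, C X) -> (forall X, C X -> is_ideal A X) ->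
  is_ideal A (\bigcup_(X in C) X).
Proof.
move=> C_chain [X0 CX0] hC; split.
- by move=> x [X /hC[XA _ _ _] Xx]; apply: XA.
- by exists X0 => //; case: (hC _ CX0).
- move=> x y [X CX Xx] [Y CY Yy].
  have [XY|YX] := C_chain X Y CX CY.
    by exists Y => //; case: (hC _ CY) => _ _ D _; apply: D => //; apply: XY.
  by exists X => //; case: (hC _ CX) => _ _ D _; apply: D => //; apply: YX.
- by move=> a x Aa [X CX Xx]; exists X => //; case: (hC _ CX) => _ _ _; apply.
Qed.

(** Finitely many generators of the union already lie in one member, which is then the whole union.
    This serves both Cohen's theorem and the maximality principle in noetherian rings. *)
Lemma fin_gen_bigcup (C : set (set K)) :
  total_on C subset -> (exists X, C X) -> (forall X, C X -> is_ideal A X) ->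
  fin_gen A (\bigcup_(X in C) X) -> C (\bigcup_(X in C) X).
Proof.
move=> C_chain C0 hC [s es].
have [|X CX sX] := chain_bigcup_seq C_chain C0 (s := s).
  by rewrite es; apply: sub_gen_ideal.
suff -> : \bigcup_(X in C) X = X by [].
apply/seteqP; split; last exact: bigcup_sup.
by rewrite es; apply: gen_ideal_min => //; apply: hC.
Qed.

(** * Zorn's lemma for ideals and Cohen's theorem *)

Lemma ideal_zorn (F : set K -> Prop) I0 :
  F I0 -> (forall I, F I -> is_ideal A I) ->
  (forall C : set (set K), C `<=` F -> total_on C subset -> (exists X, C X) ->
     F (\bigcup_(X in C) X)) ->
  exists2 M, F M & forall J, F J -> M `<=` J -> J = M.
Proof.
move=> FI0 hF FC.
(* The empty chain has union [set0], which is not an ideal; so [set0] is adjoined to [F], and ruled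
   out as a maximal element afterwards because [I0] contains 0. *)
have [C CF C_chain|M [FM Mmax]] :=
    @Zorn_bigcup K [set X | X = set0 \/ F X].
  have [[X [CX FX]]|noF] := pselect (exists X, C X /\ F X).
    right; have -> : \bigcup_(X in C) X = \bigcup_(X in C `&` F) X.
      apply/seteqP; split=> x [Y CY Yx].
        by case: (CF Y CY) => [E|FY]; [rewrite E in Yx|exists Y].
      by exists Y => //; case: CY.
    apply: FC; [by move=> Y []| |by exists X].
    by move=> Y Z [CY _] [CZ _]; apply: C_chain.
  left; rewrite -subset0 => x [Y CY Yx]; case: (CF Y CY) => [E|FY].
    by rewrite E in Yx.
  by case: noF; exists Y.
case: FM => [M0|FM].
  case: (Mmax I0); last by right.
  split; first by rewrite M0.
  by case: (hF _ FI0) => _ I00 _ _ /(_ 0 I00); rewrite M0.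
exists M => // J FJ MJ; apply/seteqP; split=> //.
by apply: contrapT => nJM; apply: (Mmax J); [split|right].
Qed.

(** An ideal [I] maximal among those not finitely generated is prime: if [x y] is in [I] but [x] and
    [y] are not, then [I + x A] and [(I : x)] are strictly larger, hence finitely generated, and [I]
    is generated by finitely many of its elements together with [x (I : x)]. *)
Lemma cohen_noetherian :
  (forall P, prime_ideal A P -> fin_gen A P) -> noetherian A.
Proof.
move=> primefg I1 hI1; apply: contrapT => nfgI1.
have [//|I []||I [hI nfg] Imax] :=
    @ideal_zorn [set I | is_ideal A I /\ ~ fin_gen A I] I1.
- by [].
- move=> C CF C_chain C0.
  have hC X : C X -> is_ideal A X by move=> /CF[].
  split; first exact: is_ideal_bigcup.
  by move=> fg; have /CF[] := fin_gen_bigcup C_chain C0 hC fg.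
have big J : is_ideal A J -> I `<` J -> fin_gen A J.
  move=> hJ [IJ nJI]; apply: contrapT => nfgJ.
  by apply: nJI; rewrite (Imax J).
apply/nfg/primefg; split=> //.
  move=> IA; apply: nfg; rewrite IA; exists [:: 1].
  apply/seteqP; split; last first.
    by apply: gen_ideal_min => [|x /=]; [exact: is_ideal_self|rewrite inE => /eqP->; apply: subring1].
  have h1 : is_ideal A (gen_ideal A [set` [:: 1 : K]]).
    by apply: is_ideal_gen => x /=; rewrite inE => /eqP->; apply: subring1.
  by rewrite (ideal_full h1) //; apply: sub_gen_ideal; rewrite /= inE.
move=> x y Ax Ay Ixy; apply: contrapT => /not_orP[nIx nIy].
have [s es] := big _ (is_ideal_add_principal hI Ax) (proper_add_principal hI nIx).
(* Each generator of [I + x A] has the form [i + a x]; [t] collects the parts [i]. *)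
have [t tI st] : exists2 t : seq K, [set` t] `<=` I &
    [set` s] `<=` add_principal A (gen_ideal A [set` t]) x.
  have : [set` s] `<=` add_principal A I x by rewrite es; apply: sub_gen_ideal.
  elim: s {es} => [|h s IH] sI; first by exists [::].
  have [|t tI st] := IH; first by move=> z zs; apply: sI; rewrite /= inE zs orbT.
  have [|i [a [Ii Aa ->]]] := sI h; first by rewrite /= inE eqxx.
  exists (i :: t); first by move=> z; rewrite /= inE => /orP[/eqP->//|]; exact: tI.
  move=> z; rewrite /= inE => /orP[/eqP->|/st[j [b [gj Ab ->]]]].
    by exists i, a; split=> //; apply: sub_gen_ideal; rewrite /= inE eqxx.
  exists j, b; split=> //; apply: gj; split.
    by apply: is_ideal_gen => w wt; case: (hI) => IA _ _ _; apply: IA;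
       move: wt; rewrite /= inE => /orP[/eqP->//|]; exact: tI.
  by move=> w wt; apply: sub_gen_ideal; rewrite /= inE; apply/orP; right.
have hc := is_ideal_colon [set x] hI.
have IA : I `<=` A by case: hI.
(* The colon ideal [(I : x)] is strictly larger than [I] because it contains [y]. *)
have [|u eu] := big _ hc.
  split; first by apply: sub_colon => // _ ->.
  by move=> /(_ y); apply: contra_not nIy; apply; split=> // _ ->; rewrite mulrC.
have uc : [set` u] `<=` colon A I [set x] by rewrite eu; apply: sub_gen_ideal.
apply: nfg; exists (t ++ [seq v * x | v <- u]).
set g := gen_ideal A _.
have gsub : [set` t ++ [seq v * x | v <- u]] `<=` I.
  move=> w; rewrite /= mem_cat => /orP[/tI//|/mapP[v vu ->]].
  by case: (uc v vu) => _; apply.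
have hg : is_ideal A g by apply: is_ideal_gen => w /gsub; apply: IA.
apply/seteqP; split; last exact: gen_ideal_min.
move=> w Iw.
have [i [a [ti Aa ew]]] : add_principal A (gen_ideal A [set` t]) x w.
  have := @sub_add_principal I x w Iw; rewrite es; apply: gen_ideal_min => //.
  apply: is_ideal_add_principal => //; apply: is_ideal_gen => z /tI; exact: IA.
have gi : g i.
  apply: (gen_ideal_min hg _ ti) => z zt.
  by apply: sub_gen_ideal; rewrite /= mem_cat; apply/orP; left.
have Ii : I i by apply: (gen_ideal_min hI tI ti).
(* From [w = i + a x] with [w] and [i] in [I], the coefficient [a] lies in [(I : x)]. *)
have ca : colon A I [set x] a.
  split=> // _ ->; have -> : a * x = w - i by rewrite ew addrAC subrr add0r.
  exact: idealB.
have gax : colon A g [set x] a.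
  move: ca; rewrite eu; apply: gen_ideal_min; first exact: is_ideal_colon.
  move=> v vu; split; first by case: (uc v vu).
  by move=> _ ->; apply: sub_gen_ideal; rewrite /= mem_cat; apply/orP; right; apply/mapP; exists v.
by rewrite ew; case: hg => _ _ D _; apply: D => //; case: gax => _; apply.
Qed.

(** * Maximality principle, noetherian induction, integrality *)

Section Noetherian.
Hypothesis A_noetherian : noetherian A.

Lemma noetherian_max (F : set K -> Prop) I0 :
  F I0 -> (forall I, F I -> is_ideal A I) ->
  exists2 M, F M & forall J, F J -> M `<=` J -> J = M.
Proof.
move=> FI0 hF; apply: (ideal_zorn FI0 hF) => C CF C_chain C0.
have hC X : C X -> is_ideal A X by move=> /CF/hF.
apply: CF; apply: (fin_gen_bigcup C_chain C0 hC); apply: A_noetherian.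
exact: is_ideal_bigcup.
Qed.

Lemma exists_maximal I :
  is_ideal A I -> ~ I 1 -> exists2 M, maximal_ideal A M & I `<=` M.
Proof.
move=> hI nI1.
have [||M [hM nM1 IM] Mmax] :=
  @noetherian_max [set J | [/\ is_ideal A J, ~ J 1 & I `<=` J]] I.
- by split.
- by move=> J [].
exists M => //; split=> //; first by move=> MA; apply: nM1; rewrite MA; apply: subring1.
move=> J hJ MJ; have [J1|nJ1] := pselect (J 1).
  by right; apply: ideal_full.
by left; apply: Mmax => //; split=> // x /IM /MJ.
Qed.

(** A maximal counterexample [I] is proper and not prime, so it contains some [x y] with [x] and [y]
    outside it, while [G] holds for the larger ideals [I + x A] and [I + y A]. *)
Lemma ideal_prime_ind (G : set K -> Prop) :
  G A -> (forall P, prime_ideal A P -> G P) ->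
  (forall I x y, is_ideal A I -> A x -> A y -> I (x * y) ->
     G (add_principal A I x) -> G (add_principal A I y) -> G I) ->
  forall I, is_ideal A I -> G I.
Proof.
move=> GA GP Gmul I0 hI0; apply: contrapT => nG.
have [||I [hI nGI] Imax] := @noetherian_max [set I | is_ideal A I /\ ~ G I] I0.
- by [].
- by move=> J [].
have big x : A x -> ~ I x -> G (add_principal A I x).
  move=> Ax nIx; apply: contrapT => nGJ.
  have [_ []] := proper_add_principal hI nIx.
  rewrite (Imax (add_principal A I x)) //; last exact: sub_add_principal.
  by split=> //; apply: is_ideal_add_principal.
apply/nGI/GP; split=> //; first by move=> E; apply: nGI; rewrite E.
move=> x y Ax Ay Ixy; apply: contrapT => /not_orP[nIx nIy].
by apply: nGI; apply: (Gmul I x y) => //; apply: big.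
Qed.

(* The powers of z, multiplied by a fixed nonzero element of M, lie in A, so
   the A-modules they span form a stationary chain of ideals. *)
Lemma stable_integral M z :
  is_ideal A M -> (exists2 a, M a & a != 0) ->
  (forall x, M x -> M (z * x)) -> integral_over A z.
Proof.
move=> hM [a Ma a0] zM; have [MA M0 MD MM] := hM.
(* [J n] is [a] times the [A]-span of the powers of [z] with exponent below [n]. *)
pose J n := [set x | exists p : {poly K},
  [/\ forall i, A p`_i, (size p <= n)%N & x = p.[z] * a]].
have zXM n : M (z ^+ n * a).
  by elim: n => [|n IH]; rewrite ?mul1r // exprS -mulrA; apply: zM.
have hJ n : is_ideal A (J n).
  split.
  - move=> _ [p [Ap _ ->]]; rewrite horner_coef mulr_suml; apply: MA.
    by apply: big_ind => // i _; rewrite -mulrA; apply: MM.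
  - exists 0; split; rewrite ?size_poly0 ?horner0 ?mul0r // => i.
    by rewrite coef0; apply: subring0.
  - move=> _ _ [p [Ap sp ->]] [q [Aq sq ->]]; exists (p + q).
    split; last by rewrite hornerD mulrDl.
      by move=> i; rewrite coefD; apply: subringD.
    by rewrite (leq_trans (size_polyD _ _)) // geq_max sp.
  - move=> c _ Ac [p [Ap sp ->]]; exists (c *: p).
    split; last by rewrite hornerZ mulrA.
      by move=> i; rewrite coefZ; apply: subringM.
    exact: leq_trans (size_scale_leq _ _) sp.
have J_mono m n : (m <= n)%N -> J m `<=` J n.
  by move=> mn _ [p [Ap sp ->]]; exists p; split=> //; apply: leq_trans mn.
have J_chain := nondecreasing_total J_mono.
have J_neq0 : exists X, range J X by exists (J 0%N), 0%N.
have J_ideal X : range J X -> is_ideal A X by move=> [n _ <-].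
have [|n _ eJ] := fin_gen_bigcup J_chain J_neq0 J_ideal.
  apply: A_noetherian; exact: is_ideal_bigcup.
have [p [Ap sp e]] : J n (z ^+ n * a).
  rewrite eJ; exists (J n.+1); first by exists n.+1.
  exists 'X^n; rewrite size_polyXn hornerXn; split=> // i.
  by rewrite coefXn; case: eqP => _; [apply: subring1|apply: subring0].
(* Stationarity gave [z ^+ n * a = p.[z] * a] with [size p <= n]: the difference is monic, and
   cancelling [a] makes [z] a root. *)
exists ('X^n - p); split.
- by rewrite monicE lead_coefDl ?lead_coefXn // size_polyN size_polyXn ltnS.
- move=> i; rewrite coefB coefXn; apply: subringB => //.
  by case: eqP => _; [apply: subring1|apply: subring0].
- rewrite rootE !hornerE subr_eq0; apply/eqP.
  exact: (mulIf a0).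
Qed.

End Noetherian.

(** * Invertibility of maximal ideals in a Dedekind domain *)

Section Dedekind.
Hypothesis A_dedekind : dedekind A.

(* A maximal element among the ideals [(aA : b)] contained in M is prime,
   hence equal to M; then [z = b / a] satisfies [zM] in [A] but not [z] in
   [A], and integral closedness excludes that [zM] lies in [M]. *)
Lemma maximal_inverse M :
  maximal_ideal A M -> (exists2 a, M a & a != 0) ->
  exists z q q', [/\ forall x, M x -> A (z * x), M q, M q' & 1 = z * q + q'].
Proof.
move=> Mmax [a Ma a0]; have [hM MnA Mmax'] := Mmax.
have [_ A_noeth A_ic A_dim1] := A_dedekind.
have [_ _ Mprime] := maximal_prime Mmax.
have nM1 := ideal_proper hM MnA.
have [MA M0 MD MM] := hM.
pose aA := [set x | exists2 c, A c & x = c * a].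
have haA : is_ideal A aA.
  split.
  - by move=> _ [c Ac ->]; apply/subringM/MA.
  - by exists 0; rewrite ?mul0r //; apply: subring0.
  - move=> _ _ [c Ac ->] [d Ad ->]; exists (c + d); rewrite ?mulrDl //.
    exact: subringD.
  - by move=> c _ Ac [d Ad ->]; exists (c * d); rewrite ?mulrA //; apply: subringM.
pose F J := exists b, [/\ A b, J = colon A aA [set b] & J `<=` M].
have colonE b x : colon A aA [set b] x <-> A x /\ aA (x * b).
  by split=> [[Ax /(_ b erefl)]|[Ax h]]; split=> // _ ->.
have [||J [b [Ab eJ JM]] Jmax] := noetherian_max A_noeth (F := F) (I0 := aA).
(* The choice [b = 1] gives [aA] itself. *)
- exists 1; split; [exact: subring1| |by move=> _ [c Ac ->]; apply: MM].
  apply/seteqP; split=> x.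
    by move=> ax; apply/colonE; rewrite mulr1; split=> //; case: haA => + _ _ _; apply.
  by move=> /colonE[]; rewrite mulr1.
- by move=> J [b [_ -> _]]; apply: is_ideal_colon.
have hJ : is_ideal A J by rewrite eJ; apply: is_ideal_colon.
have [_ _ _ aAM] := haA.
have swap x y : y * (b * x) = x * y * b by rewrite mulrCA mulrC (mulrC y).
have memJ x : J x <-> A x /\ aA (x * b) by rewrite eJ.
have Jmul x : A x -> J `<=` colon A aA [set b * x].
  move=> Ax y /memJ[Ay h]; apply/colonE; split=> //.
  by rewrite swap -mulrA; apply: aAM.
have colon_eq x : A x -> colon A aA [set b * x] `<=` M ->
    colon A aA [set b * x] = J.
  move=> Ax sM; apply: Jmax; last exact: Jmul.
  by exists (b * x); split=> //; apply: subringM.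
(* Elements [s] outside [M] cancel: by primality of [M], the ideal [(aA : b s)] stays inside [M], so
   it equals [J] by maximality. *)
have Jsat s x : A s -> ~ M s -> A x -> J (s * x) -> J x.
  move=> As nMs Ax /memJ[_ h]; rewrite -(colon_eq s) //.
    by apply/colonE; rewrite swap.
  move=> u /colonE[Au hu].
  have [|//|//] := Mprime u s Au As.
  by apply: JM; apply/memJ; split; [apply: subringM|rewrite (mulrC u) -swap].
have nJ1 : ~ J 1 by move=> /JM.
have Jprime : prime_ideal A J.
  split=> //; first by move=> E; apply: nJ1; rewrite E; apply: subring1.
  move=> x y Ax Ay /memJ[_ h]; have [Jx|nJx] := pselect (J x); [by left|right].
  rewrite -(colon_eq x) //; first by apply/colonE; rewrite swap.
  (* An [s] outside [M] in [(aA : b x)] would cancel from [s x] in [J] and put [x] in [J]; so this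
     colon ideal lies in [M] and equals [J]. *)
  move=> s /colonE[As hs]; apply: contrapT => nMs; apply: nJx.
  by apply: (Jsat s) => //; apply/memJ; rewrite (mulrC s) -swap; split=> //; apply: subringM.
have Ja : J a.
  apply/memJ; split; first exact: MA.
  by exists b => //; rewrite mulrC.
have {Jprime}Jmaxl : maximal_ideal A J.
  by apply: A_dim1 => // E; move: Ja; rewrite E => /eqP; apply/negP.
have MJ : M = J by apply: maximal_eq.
pose z := b / a.
have nAz : ~ A z.
  move=> Az; apply: nJ1; apply/memJ; split; first exact: subring1.
  by exists z => //; rewrite mul1r divfK.
have zM x : M x -> A (z * x).
  rewrite MJ => /memJ[_ [c Ac e]].
  by rewrite /z mulrAC (mulrC b) e mulfK.
have [q Mq nMzq] : exists2 q, M q & ~ M (z * q).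
  apply: contrapT => noq; apply: nAz; apply: A_ic.
    by exists b, a; split=> //; apply: MA.
  apply: (stable_integral A_noeth hM); first by exists a.
  by move=> x Mx; apply: contrapT => nMzx; apply: noq; exists x.
(* As [z q] is in [A] but not in [M], maximality gives [1 = m + c (z q)]. *)
have [m [c [Mm Ac e]]] : add_principal A M (z * q) 1.
  have hN := is_ideal_add_principal hM (zM _ Mq).
  case: (Mmax' _ hN) => [|E|->]; [exact: sub_add_principal| |exact: subring1].
  by case: nMzq; rewrite -E; apply: mem_add_principal.
exists z, (c * q), m; split=> //; first exact: MM.
by rewrite e addrC mulrCA.
Qed.

End Dedekind.
End Subring.

(** * Contraction and extension of ideals *)

Section Extension.
Variables (K : fieldType) (A B : set K).
Hypotheses (A_subring : is_subring A) (B_subring : is_subring B).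
Hypothesis AB : A `<=` B.

Lemma is_ideal_contract (I : set K) : is_ideal B I -> is_ideal A (I `&` A).
Proof.
move=> [IB I0 ID IM]; split.
- by move=> x [].
- by split=> //; apply: subring0.
- by move=> x y [Ix Ax] [Iy Ay]; split; [apply: ID|apply: subringD].
- by move=> a x Aa [Ix Ax]; split; [apply: IM => //; apply: AB|apply: subringM].
Qed.

Lemma prime_contract (P : set K) : prime_ideal B P -> prime_ideal A (P `&` A).
Proof.
move=> Pprime; have [hP PB PM] := Pprime; split; first exact: is_ideal_contract.
  move=> E; case: (prime_proper1 Pprime).
  by have [] : (P `&` A) 1 by rewrite E; apply: subring1.
move=> x y Ax Ay [Pxy _].
by have [] := PM _ _ (AB Ax) (AB Ay) Pxy; [left|right].
Qed.

Lemma gen_ideal_mono (S : set K) : S `<=` A -> gen_ideal A S `<=` gen_ideal B S.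
Proof.
move=> SA; apply: subset_trans (@subIsetl _ _ A).
apply: gen_ideal_min.
  by apply/is_ideal_contract/is_ideal_gen => // x /SA /AB.
by move=> x Sx; split; [apply: sub_gen_ideal|apply: SA].
Qed.

End Extension.

(** * The union of a system: integral closedness, dimension and survival *)

Section System.
Variables (K : fieldType) (D : nat -> set K).
Hypothesis hD : dedekind_system D.
Local Notation U := (\bigcup_n D n).

Lemma system_mono m n : (m <= n)%N -> D m `<=` D n.
Proof.
elim: n => [|n IH]; first by rewrite leqn0 => /eqP->.
rewrite leq_eqVlt => /orP[/eqP->//|mn]; apply: subset_trans (IH mn) _.
by case: hD => /(_ n)[_ []].
Qed.

Lemma system_dedekind n : dedekind (D n).
Proof. by case: hD => /(_ n)[]. Qed.

Lemma system_subring n : is_subring (D n).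
Proof. by case: (system_dedekind n). Qed.

Lemma sub_system_bigcup n : D n `<=` U.
Proof. exact: bigcup_sup. Qed.

Lemma system_bigcup2 x y : U x -> U y -> exists n, D n x /\ D n y.
Proof.
move=> [m _ Dx] [n _ Dy]; exists (maxn m n).
by split; [apply: system_mono Dx|apply: system_mono Dy]; rewrite ?leq_maxl ?leq_maxr.
Qed.

Lemma system_bigcup_seq (s : seq K) : [set` s] `<=` U -> exists n, [set` s] `<=` D n.
Proof.
move=> sU.
have [|||_ [n _ <-] sn] := @chain_bigcup_seq _ (range D) _ _ s; last by exists n.
- exact/nondecreasing_total/system_mono.
- by exists (D 0%N), 0%N.
- by move=> x /sU[n _ Dx]; exists (D n) => //; exists n.
Qed.

Lemma system_bigcup_subring : is_subring U.
Proof.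
split.
- apply/mem_set; exists 0%N => //; apply: subring1; exact: system_subring.
- move=> x y /set_mem Ux /set_mem Uy; have [n [Dx Dy]] := system_bigcup2 Ux Uy.
  by apply/mem_set; exists n => //; apply: subringB => //; apply: system_subring.
- move=> x y /set_mem Ux /set_mem Uy; have [n [Dx Dy]] := system_bigcup2 Ux Uy.
  by apply/mem_set; exists n => //; apply: subringM => //; apply: system_subring.
Qed.

(** Numerator, denominator and the finitely many coefficients of the integral equation all lie in a
    single [D k], which is integrally closed. *)
Lemma system_bigcup_integrally_closed : integrally_closed U.
Proof.
move=> x [a [b [Ua Ub b0 ex]]] [p [p_monic pU px]].
have [n [Da Db]] := system_bigcup2 Ua Ub.
have [|m pD] := @system_bigcup_seq p.
  by move=> _ /(nthP 0)[i _ <-]; apply: pU.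
pose k := maxn n m; exists k => //.
have [_ _ Dk_ic _] := system_dedekind k.
have nk : D n `<=` D k by apply: system_mono; apply: leq_maxl.
have mk : D m `<=` D k by apply: system_mono; apply: leq_maxr.
apply: Dk_ic; first by exists a, b; split=> //; apply: nk.
exists p; split=> // i; have [ip|ip] := ltnP i (size p).
  by apply/mk/pD/mem_nth.
(* Coefficients beyond the size of [p] are 0. *)
by rewrite nth_default //; apply: subring0; exact: system_subring.
Qed.

Lemma ideal_neq0 (A P : set K) :
  is_ideal A P -> P <> [set 0] -> exists2 x, P x & x != 0.
Proof.
move=> [_ P0 _ _] PN0; apply: contrapT => nex; apply: PN0.
apply/seteqP; split=> [x Px|_ ->//]; apply/eqP.
by case: (eqVneq x 0) => // x0; case: nex; exists x.
Qed.

Lemma neq0_ideal (P : set K) x : P x -> x != 0 -> P <> [set 0].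
Proof. by move=> Px x0 E; move: Px; rewrite E => /eqP; apply/negP. Qed.

Lemma system_prime_maximal n (P : set K) x :
  prime_ideal (D n) P -> P x -> x != 0 -> maximal_ideal (D n) P.
Proof.
move=> hP Px x0; have [_ _ _ dim1] := system_dedekind n.
by apply: dim1 => //; apply: neq0_ideal Px x0.
Qed.

Lemma system_prime_contract n (P : set K) :
  prime_ideal U P -> prime_ideal (D n) (P `&` D n).
Proof.
apply: prime_contract; [exact: system_subring|].
exact: sub_system_bigcup.
Qed.

(** If [J] is strictly larger than [P], some [D n] contains both a nonzero [x] of [P] and a [y] of
    [J] outside [P]. There the contraction of [P] is maximal, so 1 is an element of it plus a
    multiple of [y]. *)
Lemma system_bigcup_dim1 (P : set K) :
  prime_ideal U P -> P <> [set 0] -> maximal_ideal U P.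
Proof.
move=> Pprime PN0; have [hP PU _] := Pprime; have [PsubU _ _ _] := hP.
have [x Px x0] := ideal_neq0 hP PN0.
split=> // J hJ PJ; have [JP|nJP] := pselect (J `<=` P).
  by left; apply/seteqP.
right; have [JU _ JD JM] := hJ.
have [y Jy nPy] : exists2 y, J y & ~ P y.
  apply: contrapT => nex; apply: nJP => y Jy; apply: contrapT => nPy.
  by apply: nex; exists y.
have [n [Dx Dy]] := system_bigcup2 (PsubU _ Px) (JU _ Jy).
have [hQ _ Qmax] := system_prime_maximal (system_prime_contract n Pprime) (conj Px Dx) x0.
have [||E] := Qmax _ (is_ideal_add_principal (system_subring n) hQ Dy).
- by apply: sub_add_principal; apply: system_subring.
- move=> E; case: nPy.
  suff [] : (P `&` D n) y by [].
  by rewrite -E; apply: mem_add_principal => //; apply: system_subring.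
apply: ideal_full => //.
have [q [c [[Pq _] Dc ->]]] : add_principal (D n) (P `&` D n) y 1.
  by rewrite E; apply: subring1; exact: system_subring.
by apply: JD; [apply: PJ|apply: JM => //; exists n].
Qed.

(** Enlarge [I] to a maximal ideal [M] of [D n]. The extension of [M] to [U] is the union of its
    extensions to the later rings, so 1 would already appear in one of these, against the survival
    condition. *)
Lemma system_survival n (I : set K) :
  is_ideal (D n) I -> ~ I 1 -> ~ gen_ideal U I 1.
Proof.
move=> hI nI1; have [_ D_noeth _ _] := system_dedekind n.
have [M Mmax IM] := exists_maximal (system_subring n) D_noeth hI nI1.
have [[MD _ _ _] _ _] := Mmax.
pose J := [set x | exists2 k, (n < k)%N & gen_ideal (D k) M x].
have hgen k : (n < k)%N -> is_ideal (D k) (gen_ideal (D k) M).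
  move=> nk; apply: is_ideal_gen; first exact: system_subring.
  by move=> x /MD; apply: system_mono; apply: ltnW.
have gen_mono k k' x : (n < k)%N -> (k <= k')%N ->
    gen_ideal (D k) M x -> gen_ideal (D k') M x.
  move=> nk kk'; apply: gen_ideal_mono; [exact: system_subring..|exact: system_mono|].
  by move=> y /MD; apply: system_mono; apply: ltnW.
have hJ : is_ideal U J.
  split.
  - by move=> x [k nk gx]; exists k => //; case: (hgen k nk) => h _ _ _; apply: h.
  - by exists n.+1 => //; case: (hgen n.+1 (ltnSn n)).
  - move=> x y [k nk gx] [k' nk' gy].
    have nm : (n < maxn k k')%N by rewrite leq_max nk.
    exists (maxn k k') => //; case: (hgen _ nm) => _ _ gD _; apply: gD.
      by apply: gen_mono gx; rewrite ?leq_maxl.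
    by apply: gen_mono gy; rewrite ?leq_maxr.
  - move=> a x [m _ Da] [k nk gx].
    have nm : (n < maxn k m)%N by rewrite leq_max nk.
    exists (maxn k m) => //; case: (hgen _ nm) => _ _ _; apply.
      by apply: system_mono Da; rewrite leq_maxr.
    by apply: gen_mono gx; rewrite ?leq_maxl.
have IJ : I `<=` J by move=> x /IM Mx; exists n.+1 => //; apply: sub_gen_ideal.
move=> /(gen_ideal_min hJ IJ)[k nk gen1].
case: hD => _ _ /(_ n k nk M Mmax) + _; apply.
by apply: ideal_full => //; exact: hgen.
Qed.

(** * Inert primes make the union noetherian *)

Lemma system_inert_noetherian :
  (forall (n : nat) (P : set K), prime_ideal (D n) P -> P <> [set 0] ->
     exists2 l : nat, (n <= l)%N &
       forall m : nat, (l <= m)%N ->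
         forall Q : set K, prime_ideal (D m) Q -> P `<=` Q ->
           inert (D m.+1) Q) ->
  noetherian U.
Proof.
move=> hinert; apply: (cohen_noetherian system_bigcup_subring) => N Nprime.
have [hN _ _] := Nprime; have [NU N0 ND NM] := hN.
have [NE|NN0] := pselect (N = [set 0]).
  exists [::]; apply/seteqP; split.
    rewrite NE => _ ->.
    have := is_ideal_gen (S := [set` [::]]) system_bigcup_subring.
    by case.
  exact: gen_ideal_min.
have [x Nx x0] := ideal_neq0 hN NN0.
have [n _ Dx] := NU _ Nx.
(* The hypothesis is applied to the contraction of [N] to [D n], which is nonzero as it contains
   [x]. *)
have [l nl hl] := hinert n _ (system_prime_contract n Nprime)
  (neq0_ideal (conj Nx Dx) x0).
have Nl_ideal : is_ideal (D l) (N `&` D l) by case: (system_prime_contract l Nprime).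
have [_ Dl_noeth _ _] := system_dedekind l.
have [s es] := Dl_noeth _ Nl_ideal.
have sN : [set` s] `<=` N `&` D l by rewrite es; apply: sub_gen_ideal.
have hg : is_ideal U (gen_ideal U [set` s]).
  apply: is_ideal_gen; first exact: system_bigcup_subring.
  by move=> y /sN[+ _]; exact: NU.
exists s; apply/seteqP; split; last by apply: gen_ideal_min => // y /sN[].
(* The generators [s] of the contraction to [D l] are shown, by induction on [m], to generate every
   later contraction over [U]. *)
suff Ng m : (l <= m)%N -> N `&` D m `<=` gen_ideal U [set` s].
  move=> y Ny; have [m _ Dy] := NU _ Ny.
  apply: (Ng (maxn l m) (leq_maxl _ _)); split=> //.
  by apply: system_mono Dy; apply: leq_maxr.
have contract k : is_ideal (D k) (gen_ideal U [set` s] `&` D k).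
  by apply: is_ideal_contract hg; [exact: system_subring|exact: sub_system_bigcup].
have base : N `&` D l `<=` gen_ideal U [set` s].
  rewrite {1}es; apply: subset_trans (@subIsetl _ _ (D l)).
  apply: gen_ideal_min => // y sy; split; first exact: sub_gen_ideal.
  by case: (sN _ sy).
elim: m => [|m IH]; first by rewrite leqn0 => /eqP <-.
rewrite leq_eqVlt => /orP[/eqP <- //|lm].
have nm : (n <= m)%N by apply: leq_trans nl _.
have Qprime := system_prime_contract m Nprime.
have inertQ : inert (D m.+1) (N `&` D m).
  apply: (hl m) => // y [Ny Dy]; split=> //; exact: system_mono Dy.
have Q'prime := system_prime_contract m.+1 Nprime.
have DmS : D m `<=` D m.+1 by apply: system_mono.
have QQ' : N `&` D m `<=` N `&` D m.+1 by move=> y [Ny /DmS].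
have [hQ' _ _] := Q'prime.
have gx : gen_ideal (D m.+1) (N `&` D m) x.
  by apply: sub_gen_ideal; split=> //; exact: system_mono Dx.
(* The inert extension of [Q = N ∩ D_m] is a nonzero prime, hence maximal, and so fills the proper
   ideal [N ∩ D_{m+1}] containing it. *)
have E := maximal_eq (system_subring _) (system_prime_maximal inertQ gx x0) hQ'
  (prime_proper1 Q'prime) (gen_ideal_min hQ' QQ').
rewrite E; apply: subset_trans (@subIsetl _ _ (D m.+1)).
apply: gen_ideal_min => // y Qy; split; first exact: IH.
by apply: DmS; case: Qy.
Qed.

(** * A noetherian union makes primes inert *)

Lemma gen_contract_mono l m (N : set K) : is_ideal U N -> (l <= m)%N ->
  gen_ideal U (N `&` D l) `<=` gen_ideal U (N `&` D m).
Proof.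
move=> [NU _ _ _] lm; apply: gen_ideal_min.
  by apply: is_ideal_gen; [exact: system_bigcup_subring|move=> x [/NU]].
move=> x [Nx Dx]; apply: sub_gen_ideal; split=> //; exact: system_mono Dx.
Qed.

(** A nonzero prime [P] of [U] is maximal, so it is the only prime above itself, and its finitely
    many generators lie in one [D l]. If [x y] is in [I], each prime above [I] contains [x] or [y],
    and the larger of the two levels works. *)
Lemma noetherian_primes_bounded_level (I : set K) : noetherian U ->
  is_ideal U I -> I <> [set 0] ->
  exists l, forall N, prime_ideal U N -> I `<=` N ->
    N `<=` gen_ideal U (N `&` D l).
Proof.
move=> U_noeth hI IN0; have [x0 Ix0 x0N0] := ideal_neq0 hI IN0.
(* A fixed nonzero [x0] in [I] passes to all larger ideals, so it carries nonvanishing through the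
   induction. *)
move: I hI Ix0 {IN0}; apply: (ideal_prime_ind system_bigcup_subring U_noeth).
- move=> Ux0; exists 0%N => N Nprime UN.
  case: (prime_proper1 Nprime).
  by apply: UN; apply: subring1 system_bigcup_subring.
- move=> P Pprime Px0.
  have Pmax := system_bigcup_dim1 Pprime (neq0_ideal Px0 x0N0).
  have [hP _ _] := Pprime; have [PU _ _ _] := hP.
  have [s es] := U_noeth _ hP.
  have sP : [set` s] `<=` P by rewrite es; apply: sub_gen_ideal.
  have [l sl] := system_bigcup_seq (subset_trans sP PU).
  exists l => N Nprime PN.
  have [hN _ _] := Nprime.
  have -> : N = P.
    apply: (maximal_eq system_bigcup_subring Pmax) => //.
    exact: (prime_proper1 Nprime).
  rewrite {1}es; apply: gen_ideal_min.
    by apply: is_ideal_gen; [exact: system_bigcup_subring|move=> y [/PU]].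
  by move=> y sy; apply: sub_gen_ideal; split; [exact: sP|exact: sl].
- move=> I x y hI Ux Uy Ixy hx hy Ix0.
  have sub z := @sub_add_principal _ _ system_bigcup_subring I z.
  have [l1 hl1] := hx (sub x _ Ix0).
  have [l2 hl2] := hy (sub y _ Ix0).
  exists (maxn l1 l2) => N Nprime IN; have [hN _ NP] := Nprime.
  have addN z : N z -> add_principal U I z `<=` N.
    move=> Nz _ [i [a [Ii Ua ->]]]; case: hN => _ _ ND NM.
    by apply: ND; [apply: IN|apply: NM].
  have [Nx|Ny] := NP x y Ux Uy (IN _ Ixy).
    apply: subset_trans (hl1 N Nprime (addN _ Nx)) _.
    by apply: gen_contract_mono => //; apply: leq_maxl.
  apply: subset_trans (hl2 N Nprime (addN _ Ny)) _.
  by apply: gen_contract_mono => //; apply: leq_maxr.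
Qed.

(* With [z M] in [D n] and [1 = z q + q'] for [q], [q'] in the maximal ideal
   [M], both [z Q] and [Q] lie in [(Q D_n : M)], and [q], [q'] lie in [Q U];
   so [(Q D_n : M)] generates the unit ideal of [U], and survival forces it to
   be all of [D n]. *)
Lemma gen_ideal_eq_maximal n (M Q : set K) x :
  maximal_ideal (D n) M -> M x -> x != 0 ->
  Q `<=` M -> M `<=` gen_ideal U Q -> gen_ideal (D n) Q = M.
Proof.
move=> Mmax Mx x0 QM MQ.
have Dsub := system_subring n; have Usub := system_bigcup_subring.
have [hM _ _] := Mmax; have [MD _ _ _] := hM.
have QD : Q `<=` D n by apply: subset_trans MD.
have hg : is_ideal (D n) (gen_ideal (D n) Q) by apply: is_ideal_gen.
have gQM := gen_ideal_min hM QM.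
apply/seteqP; split=> //.
have [z [q [q' [zM Mq Mq' e]]]] : exists z q q',
    [/\ forall x, M x -> D n (z * x), M q, M q' & 1 = z * q + q'].
  by apply: (maximal_inverse Dsub (system_dedekind n) Mmax); exists x.
pose C := colon (D n) (gen_ideal (D n) Q) M.
have hC : is_ideal (D n) C by apply: is_ideal_colon.
have QC : Q `<=` C.
  by move=> r Qr; apply: sub_colon => //; apply: sub_gen_ideal.
have zQC r : Q r -> C (z * r).
  move=> Qr; split; first by apply/zM/QM.
  move=> y My; rewrite mulrAC; case: hg => _ _ _; apply; first exact: zM.
  exact: sub_gen_ideal.
have hUC : is_ideal U (gen_ideal U C).
  by apply: is_ideal_gen => // c [Dc _]; exists n.
have [_ _ UCD UCM] := hUC.
have C1 : C 1.
  apply: contrapT => nC1; apply: (system_survival hC nC1); rewrite e.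
  apply: UCD; last first.
    apply: (gen_ideal_min hUC _ (MQ _ Mq')) => r /QC; exact: sub_gen_ideal.
  (* The elements [c] of [U] with [c z] in the extension of [C] form an ideal of [U]; it contains
     [Q], hence also [q]. *)
  suff [] : colon U (gen_ideal U C) [set z] q by move=> _ /(_ z erefl); rewrite mulrC.
  apply: gen_ideal_min (MQ _ Mq); first exact: is_ideal_colon.
  move=> r Qr; split; first by exists n => //; apply: QD.
  by move=> _ ->; rewrite mulrC; apply: sub_gen_ideal; exact: zQC.
by move=> y My; case: C1 => _ /(_ y My); rewrite mul1r.
Qed.

Lemma system_noetherian_inert : noetherian U ->
  forall (n : nat) (P : set K), prime_ideal (D n) P -> P <> [set 0] ->
     exists2 l : nat, (n <= l)%N &
       forall m : nat, (l <= m)%N ->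
         forall Q : set K, prime_ideal (D m) Q -> P `<=` Q ->
           inert (D m.+1) Q.
Proof.
move=> U_noeth n P [hP _ _] PN0.
have Usub := system_bigcup_subring.
have [x Px x0] := ideal_neq0 hP PN0.
have PU : P `<=` U by case: hP => PD _ _ _; apply: subset_trans PD _; apply: sub_system_bigcup.
(* The level is taken for the extension of [P] to [U], so it serves all primes of [U] above [P] at
   once. *)
have [l0 hl0] := noetherian_primes_bounded_level U_noeth (is_ideal_gen Usub PU)
  (neq0_ideal (sub_gen_ideal Px) x0).
exists (maxn n l0) => [|m]; first exact: leq_maxl.
rewrite geq_max => /andP[nm l0m] Q Qprime PQ.
have [hQ _ _] := Qprime; have [QD _ _ _] := hQ.
have Qmax := system_prime_maximal Qprime (PQ _ Px) x0.
have QU : Q `<=` U by apply: subset_trans QD _; apply: sub_system_bigcup.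
have [N Nmax QN] := exists_maximal Usub U_noeth (is_ideal_gen Usub QU)
  (system_survival hQ (prime_proper1 Qprime)).
have {}QN : Q `<=` N by move=> y Qy; apply: QN; exact: sub_gen_ideal.
have Nprime := maximal_prime Usub Nmax; have [hN _ _] := Nprime.
(* [Q] is maximal in [D m] and the contraction of [N] is proper, so they agree. *)
have NmE : N `&` D m = Q.
  have [hNm _ _] := system_prime_contract m Nprime.
  apply: (maximal_eq (system_subring m) Qmax hNm).
    by move=> [/(prime_proper1 Nprime)].
  by move=> y Qy; split; [exact: QN|exact: QD].
have NQ : N `<=` gen_ideal U Q.
  have PN : P `<=` N by move=> y /PQ/QN.
  apply: subset_trans (hl0 N Nprime (gen_ideal_min hN PN)) _.
  by rewrite -NmE; apply: gen_contract_mono.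
have DmS : D m `<=` D m.+1 by apply: system_mono.
have Q'prime := system_prime_contract m.+1 Nprime.
have Q'x : (N `&` D m.+1) x.
  by split; [apply/QN/PQ|apply/DmS/QD/PQ].
(* The extension of [Q] to [D m.+1] equals the contraction of [N], which is prime. *)
rewrite /inert (gen_ideal_eq_maximal (system_prime_maximal Q'prime Q'x x0) Q'x x0) //.
  by move=> y Qy; split; [exact: QN|apply/DmS/QD].
by move=> y [/NQ].
Qed.

End System.

Theorem corollary2p8 (K : fieldType) (D : nat -> set K)
    (hD : dedekind_system D) :
  dedekind (\bigcup_n D n) <->
  (forall (n : nat) (P : set K), prime_ideal (D n) P -> P <> [set 0] ->
     exists2 l : nat, (n <= l)%N &
       forall m : nat, (l <= m)%N ->
         forall Q : set K, prime_ideal (D m) Q -> P `<=` Q ->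
           inert (D m.+1) Q).
Proof.
split=> [[_ U_noeth _ _]|hinert]; first exact: system_noetherian_inert.
split.
- exact: system_bigcup_subring.
- exact: system_inert_noetherian.
- exact: system_bigcup_integrally_closed.
- exact: system_bigcup_dim1.
Qed.
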